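(* Fix $T>0$, $\rho_T>0$, assume $\mathbb{E}_{\mathbb{P}_T^\circ}[\boldsymbol{\xi}_T\boldsymbol{\xi}_T^\ast]=\mathcal{I}$, and set $\mathcal{K}_T^\circ=\mathcal{L}_T\mathcal{H}_T^\ast(\mathcal{I}+\mathcal{H}_T\mathcal{H}_T^\ast)^{-1}$ and $\mathcal{T}_{\mathcal{K}_T^\circ}\mathcal{T}_{\mathcal{K}_T^\circ}^\ast:=\mathcal{L}_T(\mathcal{I}+\mathcal{H}_T^\ast\mathcal{H}_T)^{-1}\mathcal{L}_T^\ast$. Then the finite-horizon distributionally robust filtering problem $\inf_{\mathcal{K}_T\in\mathscr{K}_T}\sup_{\mathbb{P}_T\in\mathcal{W}_T(\mathbb{P}_T^\circ,\rho_T)}\mathbb{E}_{\mathbb{P}_T}\|\mathcal{T}_{\mathcal{K}_T}\boldsymbol{\xi}_T\|^2$ reduces to the semidefinite program $$\inf_{\mathcal{K}_T\in\mathscr{K}_T,\ \gamma\ge0,\ \mathcal{X}_T\succeq0}\ \gamma(\rho_T^2-\mathrm{Tr}(\mathcal{I}_T))+\mathrm{Tr}(\mathcal{X}_T)\quad\text{s.t.}\quad\begin{bmatrix}\mathcal{X}_T&\gamma\mathcal{I}_T&0\\ \gamma\mathcal{I}_T&\gamma\mathcal{I}_T-\mathcal{T}_{\mathcal{K}_T^\circ}\mathcal{T}_{\mathcal{K}_T^\circ}^\ast&\mathcal{K}_T-\mathcal{K}_T^\circ\\ 0&(\mathcal{K}_T-\mathcal{K}_T^\circ)^\ast&(\mathcal{I}+\mathcal{H}_T\mathcal{H}_T^\ast)^{-1}\end{bmatrix}\succeq0,$$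 where $\mathcal{X}_T\in\mathbb{R}^{Td_s\times Td_s}$ and $\mathcal{I}_T$ is the $Td_s\times Td_s$ identity. Moreover, the worst-case disturbance is obtained from the nominal disturbance $\boldsymbol{\xi}_T^\circ$ as $\boldsymbol{\xi}_T^\star=(\mathcal{I}-\gamma_\star^{-1}\mathcal{T}_{\mathcal{K}_T^\star}^\ast\mathcal{T}_{\mathcal{K}_T^\star})^{-1}\boldsymbol{\xi}_T^\circ$, where $\gamma_\star>0$ and $\mathcal{K}_T^\star$ are the optimal solutions.
   Context: State-space model: $x_{t+1}=Ax_t+Bw_t$, $y_t=C_yx_t+v_t$, $s_t=C_sx_t$ ($s_t\in\mathbb{R}^{d_s}$, $y_t\in\mathbb{R}^{d_y}$), with $(A,C_y)$, $(A,C_s)$ detectable and $(A,B)$ controllable. For horizon $T$: $\mathbf{y}_T=[y_0;\dots;y_{T-1}]$, $\mathbf{s}_T=[s_0;\dots;s_{T-1}]$, $\mathbf{w}_T=[x_0;w_0;\dots;w_{T-2}]$, $\mathbf{v}_T=[v_0;\dots;v_{T-1}]$, $\boldsymbol{\xi}_T=[\mathbf{w}_T;\mathbf{v}_T]$, with $\mathbf{y}_T=\mathcal{H}_T\mathbf{w}_T+\mathbf{v}_T$, $\mathbf{s}_T=\mathcal{L}_T\mathbf{w}_T$ for the block lower-triangular matrices $\mathcal{H}_T,\mathcal{L}_T$ determined by the model (the $t$-th block of $\mathcal{H}_T\mathbf{w}_T$ is $C_yA^tx_0+\sum_{\tau<t}C_yA^{t-1-\tau}Bw_\tau$, similarly for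 $\mathcal{L}_T$ with $C_s$). $\mathscr{K}_T$ is the set of block lower-triangular (causal) matrices $\mathcal{K}_T\in\mathbb{R}^{Td_s\times Td_y}$; the estimate is $\widehat{\mathbf{s}}_T=\mathcal{K}_T\mathbf{y}_T$ and the error is $\mathcal{T}_{\mathcal{K}_T}\boldsymbol{\xi}_T$ with $\mathcal{T}_{\mathcal{K}_T}=[\mathcal{K}_T\mathcal{H}_T-\mathcal{L}_T,\ \mathcal{K}_T]$. Disturbances are zero-mean. $\mathcal{W}_T(\mathbb{P}_T^\circ,\rho_T)$ is the set of distributions with finite second moment at Wasserstein-2 distance at most $\rho_T$ from the nominal $\mathbb{P}_T^\circ$, with $\mathsf{W}_2(\mathbb{P}_1,\mathbb{P}_2)=(\inf\mathbb{E}\|\mathbf{w}_1-\mathbf{w}_2\|^2)^{1/2}$ over couplings. *)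

(* Defs.v *)
From HB Require Import structures.
From mathcomp Require Import all_boot all_order all_algebra.
From mathcomp Require Import all_classical all_reals all_analysis.
Set Implicit Arguments. Unset Strict Implicit. Unset Printing Implicit Defensive.
Import Order.TTheory GRing.Theory Num.Theory.
Import numFieldNormedType.Exports.
Local Open Scope classical_set_scope.
Local Open Scope ring_scope.

Section DRDefs.
Variable R : realType.

Definition entry p q (M : 'M[R]_(p, q)) (a b : nat) : R :=
  if (insub a : option 'I_p) is Some i then
    if (insub b : option 'I_q) is Some j then M i j else 0
  else 0.

Definition schur_stable n (M : 'M[R]_n) : Prop :=
  forall i j, (fun k : nat => (M ^+ k) i j) @ \oo --> (0 : R).

Definition detectable n p (A : 'M[R]_n) (C : 'M[R]_(p, n)) : Prop :=
  exists Lg : 'M[R]_(n, p), schur_stable (A - Lg *m C).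

(** Kalman controllability matrix [B, AB, ..., A^(n-1) B]. *)
Definition ctrb_mx n m (A : 'M[R]_n) (B : 'M[R]_(n, m)) : 'M[R]_(n, n * m) :=
  \matrix_(i < n, j < n * m) entry (A ^+ (j %/ m) *m B) i (j %% m).

Definition controllable n m (A : 'M[R]_n) (B : 'M[R]_(n, m)) : Prop :=
  \rank (ctrb_mx A B) = n.

(** The block lower-triangular map from w_T = [x_0; w_0; ...; w_(T-2)] to
    [z_0; ...; z_(T-1)] with z_t = C A^t x_0 + sum_(tau<t) C A^(t-1-tau) B w_tau. *)
Definition io_mx n dw dz T (A : 'M[R]_n) (B : 'M[R]_(n, dw)) (C : 'M[R]_(dz, n))
  : 'M[R]_(T * dz, n + T.-1 * dw) :=
  \matrix_(i < T * dz, j < n + T.-1 * dw)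
    let t := (i %/ dz)%N in
    match fintype.split j with
    | inl j0 => entry (C *m A ^+ t) (i %% dz) j0
    | inr j1 => let tau := (j1 %/ dw)%N in
                if (tau < t)%N then entry (C *m A ^+ (t.-1 - tau) *m B) (i %% dz) (j1 %% dw)
                else 0
    end.

Definition causal ds dy T (K : 'M[R]_(T * ds, T * dy)) : Prop :=
  forall (i : 'I_(T * ds)) (j : 'I_(T * dy)), (i %/ ds < j %/ dy)%N -> K i j = 0.

Definition err_mx ds dy Nw T (H : 'M[R]_(T * dy, Nw)) (L : 'M[R]_(T * ds, Nw))
  (K : 'M[R]_(T * ds, T * dy)) : 'M[R]_(T * ds, Nw + T * dy) :=
  row_mx (K *m H - L) K.

Definition psd m (M : 'M[R]_m) : Prop :=
  M^T = M /\ forall x : 'cV[R]_m, 0 <= (x^T *m M *m x) 0 0.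

(** Vectors of R^N are represented as N-tuples (with the product Borel
    sigma-algebra of mathcomp-analysis); tvec views them as column vectors. *)
Definition tvec N (x : N.-tuple R) : 'cV[R]_N := \col_i tnth x i.
Definition vtup N (v : 'cV[R]_N) : N.-tuple R := [tuple v i 0 | i < N].

Definition sqnorm N (v : 'cV[R]_N) : R := \sum_i (v i 0) ^+ 2.

Definition finite_second_moment N (P : probability (N.-tuple R) R) : Prop :=
  forall i : 'I_N, P.-integrable setT (fun x => ((tnth x i) ^+ 2)%:E).

Definition coupling N (P1 P2 : probability (N.-tuple R) R)
  (pi : probability (N.-tuple R * N.-tuple R)%type R) : Prop :=
  forall A : set (N.-tuple R), measurable A ->
    pi (A `*` setT) = P1 A /\ pi (setT `*` A) = P2 A.

Definition W2sq N (P1 P2 : probability (N.-tuple R) R) : \bar R :=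
  ereal_inf [set (\int[pi]_z (sqnorm (tvec z.1 - tvec z.2))%:E)%E
            | pi in [set pi | coupling P1 P2 pi]].

(** Wasserstein ball W(P0, rho) (W2 <= rho <-> W2^2 <= rho^2). *)
Definition wball N (P0 : probability (N.-tuple R) R) (rho : R)
  : set (probability (N.-tuple R) R) :=
  [set P | finite_second_moment P /\ (W2sq P P0 <= (rho ^+ 2)%:E)%E].

Definition cost N p (P : probability (N.-tuple R) R) (M : 'M[R]_(p, N)) : \bar R :=
  (\int[P]_x (sqnorm (M *m tvec x))%:E)%E.

Section Problem.
Variables (n dw dy ds T : nat).
Variables (A : 'M[R]_n) (B : 'M[R]_(n, dw)) (Cy : 'M[R]_(dy, n)) (Cs : 'M[R]_(ds, n)).

Definition HT := io_mx T A B Cy.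
Definition LT := io_mx T A B Cs.

Notation Nxi := (n + T.-1 * dw + T * dy)%N.

Definition TK (K : 'M[R]_(T * ds, T * dy)) : 'M[R]_(T * ds, Nxi) := err_mx HT LT K.

Definition Kcirc : 'M[R]_(T * ds, T * dy) := LT *m HT^T *m invmx (1%:M + HT *m HT^T).

Definition TTcirc : 'M[R]_(T * ds) := LT *m invmx (1%:M + HT^T *m HT) *m LT^T.

Definition worst_cost (P0 : probability (Nxi.-tuple R) R) (rho : R)
    (K : 'M[R]_(T * ds, T * dy)) : \bar R :=
  ereal_sup [set cost P (TK K) | P in wball P0 rho].

Definition dr_value (P0 : probability (Nxi.-tuple R) R) (rho : R) : \bar R :=
  ereal_inf [set worst_cost P0 rho K | K in [set K | causal K]].

Definition sdp_lmi (K : 'M[R]_(T * ds, T * dy)) (g : R) (X : 'M[R]_(T * ds))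
  : 'M[R]_(T * ds + (T * ds + T * dy)) :=
  block_mx X (row_mx (g%:M) 0)
           (col_mx (g%:M) 0)
           (block_mx (g%:M - TTcirc) (K - Kcirc)
                     (K - Kcirc)^T (invmx (1%:M + HT *m HT^T))).

Definition sdp_feasible (K : 'M[R]_(T * ds, T * dy)) (g : R) (X : 'M[R]_(T * ds)) : Prop :=
  [/\ causal K, 0 <= g, psd X & psd (sdp_lmi K g X)].

Definition sdp_obj (rho : R) (g : R) (X : 'M[R]_(T * ds)) : R :=
  g * (rho ^+ 2 - (T * ds)%:R) + \tr X.

Definition sdp_value (rho : R) : \bar R :=
  ereal_inf [set (sdp_obj rho z.2 z.1.2)%:E
            | z in [set z : 'M[R]_(T * ds, T * dy) * 'M[R]_(T * ds) * R
                   | sdp_feasible z.1.1 z.2 z.1.2]].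

Definition sdp_optimal (rho : R) (K : 'M[R]_(T * ds, T * dy)) (g : R) (X : 'M[R]_(T * ds)) : Prop :=
  sdp_feasible K g X /\ (sdp_obj rho g X)%:E = sdp_value rho.

End Problem.
End DRDefs.

(* Main.v *)
(** For a fixed estimator with error operator [T], put [S = T T^T], [M = T^T T]
    and [mu = 1/gamma]. When [1 - mu S] is positive definite, with inverse [R],
    completing the square gives, for [u = x - y] and [V = mu T^T R T],
      [gamma |u|^2 + gamma y^T V y - |T x|^2
         = gamma (u - V y)^T (1 - mu M) (u - V y) >= 0].
    Integrating over near-optimal couplings bounds the worst-case cost by
    [gamma (rho^2 + tr V)], which is the SDP objective at the smallest [X]
    allowed by the Schur complement. As [mu] goes from [0] to the point where
    [1 - mu S] becomes singular, [tr (V^2) = tr ((R - 1)^2)] goes from [0] to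
    infinity, so it equals [rho^2] for some [mu]; the image of the nominal law
    under [1 + V = (1 - mu M)^-1] then lies in the ball and attains the bound.
    Any other optimal multiplier makes the square above vanish, hence has the
    same [V]. *)

Require Import Defs.
From HB Require Import structures.
From mathcomp Require Import all_boot all_order all_algebra.
From mathcomp Require Import ring lra.
From mathcomp Require Import all_classical all_reals all_analysis.
From mathcomp Require Import measurable_realfun.
Set Implicit Arguments.
Unset Strict Implicit.
Unset Printing Implicit Defensive.
Import Order.TTheory GRing.Theory Num.Theory.
Local Open Scope classical_set_scope.
Local Open Scope ring_scope.

(** * Quadratic forms *)

Section QuadraticForms.
Variable R : realType.
Implicit Types (p q r N : nat) (c t mu : R).

Definition bform p q (A : 'M[R]_(p, q)) (x : 'cV[R]_p) (y : 'cV[R]_q) : R :=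
  (x^T *m A *m y) 0 0.

Lemma bformDl p q (A : 'M[R]_(p, q)) x x' y :
  bform A (x + x') y = bform A x y + bform A x' y.
Proof. by rewrite /bform linearD !mulmxDl mxE. Qed.

Lemma bformDr p q (A : 'M[R]_(p, q)) x y y' :
  bform A x (y + y') = bform A x y + bform A x y'.
Proof. by rewrite /bform mulmxDr mxE. Qed.

Lemma bformZl p q (A : 'M[R]_(p, q)) c x y : bform A (c *: x) y = c * bform A x y.
Proof. by rewrite /bform linearZ /= -!scalemxAl mxE. Qed.

Lemma bformZr p q (A : 'M[R]_(p, q)) c x y : bform A x (c *: y) = c * bform A x y.
Proof. by rewrite /bform -scalemxAr mxE. Qed.

Lemma bform_tr p q (A : 'M[R]_(p, q)) x y : bform A x y = bform A^T y x.
Proof.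
rewrite /bform; have -> : y^T *m A^T *m x = (x^T *m A *m y)^T.
  by rewrite !trmx_mul trmxK mulmxA.
by rewrite [RHS]mxE.
Qed.

Lemma bform_sym p (A : 'M[R]_p) x y : A^T = A -> bform A y x = bform A x y.
Proof. by move=> sA; rewrite bform_tr sA. Qed.

Lemma bformD p q (A B : 'M[R]_(p, q)) x y :
  bform (A + B) x y = bform A x y + bform B x y.
Proof. by rewrite /bform mulmxDr mulmxDl mxE. Qed.

Lemma bformZ p q c (A : 'M[R]_(p, q)) x y : bform (c *: A) x y = c * bform A x y.
Proof. by rewrite /bform -scalemxAr -scalemxAl mxE. Qed.

Lemma bformN p q (A : 'M[R]_(p, q)) x y : bform (- A) x y = - bform A x y.
Proof. by rewrite -scaleN1r bformZ mulN1r. Qed.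

Lemma bformB p q (A B : 'M[R]_(p, q)) x y :
  bform (A - B) x y = bform A x y - bform B x y.
Proof. by rewrite bformD bformN. Qed.

Lemma bformMr p q r (A : 'M[R]_(p, q)) (B : 'M[R]_(q, r)) x y :
  bform (A *m B) x y = bform A x (B *m y).
Proof. by rewrite /bform !mulmxA. Qed.

Lemma bformMl p q r (A : 'M[R]_(p, q)) (B : 'M[R]_(q, r)) x y :
  bform (A *m B) x y = bform B (A^T *m x) y.
Proof. by rewrite /bform trmx_mul trmxK !mulmxA. Qed.

Lemma bform0l p q (A : 'M[R]_(p, q)) y : bform A 0 y = 0.
Proof. by rewrite /bform trmx0 !mul0mx mxE. Qed.

Lemma bform0r p q (A : 'M[R]_(p, q)) x : bform A x 0 = 0.
Proof. by rewrite /bform mulmx0 mxE. Qed.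

Lemma bform0 p q (x : 'cV[R]_p) (y : 'cV[R]_q) : bform 0 x y = 0.
Proof. by rewrite /bform mulmx0 mul0mx mxE. Qed.

Lemma bform_delta p q (A : 'M[R]_(p, q)) i j :
  bform A (delta_mx i 0) (delta_mx j 0) = A i j.
Proof. by rewrite /bform trmx_delta -rowE -colE !mxE. Qed.

Lemma bformE p q (A : 'M[R]_(p, q)) x y :
  bform A x y = \sum_i \sum_j A i j * (x i 0 * y j 0).
Proof.
rewrite /bform -mulmxA mxE; apply: eq_bigr => i _; rewrite !mxE mulr_sumr.
by apply: eq_bigr => j _; ring.
Qed.

Lemma tr_bform p (A : 'M[R]_p) :
  \tr A = \sum_i bform A (delta_mx i 0) (delta_mx i 0).
Proof. by apply: eq_bigr => i _; rewrite bform_delta. Qed.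

Lemma sqnormE p (x : 'cV[R]_p) : sqnorm x = bform 1%:M x x.
Proof.
rewrite /sqnorm /bform mulmx1 mxE; apply: eq_bigr => i _.
by rewrite mxE expr2.
Qed.

Lemma bform_scalar p c (x y : 'cV[R]_p) : bform c%:M x y = c * bform 1%:M x y.
Proof. by rewrite -(scalemx1 _ c) bformZ. Qed.

Lemma sqnorm_ge0 p (x : 'cV[R]_p) : 0 <= sqnorm x.
Proof. by apply: sumr_ge0 => i _; rewrite sqr_ge0. Qed.

Lemma sqnorm_eq0 p (x : 'cV[R]_p) : sqnorm x = 0 -> x = 0.
Proof.
move=> x0; apply/matrixP => i j; rewrite (ord1 j) mxE.
have /eqP := x0; rewrite psumr_eq0 => [|k _]; last exact: sqr_ge0.
by move=> /allP/(_ i (mem_index_enum _)); rewrite /= sqrf_eq0 => /eqP.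
Qed.

Lemma sqnorm_mul p q (A : 'M[R]_(p, q)) x : sqnorm (A *m x) = bform (A^T *m A) x x.
Proof. by rewrite sqnormE /bform trmx_mul mulmx1 !mulmxA. Qed.

Lemma psdP p (A : 'M[R]_p) : psd A <-> A^T = A /\ forall x, 0 <= bform A x x.
Proof. by []. Qed.

(** Cauchy-Schwarz in disguise: nonnegativity of the form at [x + t *: (A *m x)] for a suitable
    negative [t] forces the squared norm of [A *m x] to vanish. *)
Lemma psd_ker p (A : 'M[R]_p) x : psd A -> bform A x x = 0 -> A *m x = 0.
Proof.
move=> /psdP[sA pA] x0; set y := A *m x.
have yy : bform A x y = sqnorm y by rewrite sqnorm_mul sA bformMr.
set c := bform A y y; have c0 : 0 <= c by exact: pA.
have b0 := sqnorm_ge0 y.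
have key t : 0 <= 2 * t * sqnorm y + t ^+ 2 * c.
  have := pA (x + t *: y); rewrite !(bformDl, bformDr, bformZl, bformZr) x0.
  by rewrite (bform_sym x y sA) yy -/c => h; apply: le_trans h _; lra.
(* The value [t = - s * sqnorm y] makes both terms quadratic in [sqnorm y]; dividing by [c + 1]
   instead of [c] covers the case [c = 0]. *)
apply: sqnorm_eq0; set s := (c + 1)^-1.
have s0 : 0 < s by rewrite invr_gt0; lra.
have sc : s * c = 1 - s.
  have : s * (c + 1) = 1 by rewrite mulVf // gt_eqF //; lra.
  by rewrite mulrDr mulr1 => <-; rewrite addrK.
have := key (- s * sqnorm y).
have -> : 2 * (- s * sqnorm y) * sqnorm y + (- s * sqnorm y) ^+ 2 * c =
  - (s * sqnorm y ^+ 2 * (2 - s * c)) by ring.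
rewrite sc oppr_ge0 => h.
have /eqP : s * sqnorm y ^+ 2 * (2 - (1 - s)) = 0.
  apply/eqP; rewrite eq_le h /= mulr_ge0 ?mulr_ge0 ?sqr_ge0 //; lra.
have s1 : 0 < 2 - (1 - s) by lra.
by rewrite !mulf_eq0 orbb (gt_eqF s0) (gt_eqF s1) orbF => /eqP.
Qed.

Lemma ker0_unitmx p (A : 'M[R]_p) :
  (forall x : 'cV[R]_p, A *m x = 0 -> x = 0) -> A \in unitmx.
Proof.
move=> kA; rewrite -unitmx_tr unitmxE unitfE; apply/negP => /det0P[v v0 vA].
have /kA/(congr1 trmx) : A *m v^T = 0 by rewrite -[A]trmxK -trmx_mul vA trmx0.
by rewrite trmxK trmx0 => vE; rewrite vE eqxx in v0.
Qed.

Lemma psd_gram p q (A : 'M[R]_(p, q)) : psd (A *m A^T).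
Proof.
apply/psdP; split=> [|x]; first by rewrite trmx_mul trmxK.
by have := sqnorm_ge0 (A^T *m x); rewrite sqnorm_mul trmxK.
Qed.

Lemma unitmx_add1_gram p q (A : 'M[R]_(p, q)) : 1%:M + A *m A^T \in unitmx.
Proof.
apply: ker0_unitmx => x /(congr1 (fun v => bform 1%:M x v)).
rewrite -bformMr mul1mx bformD -sqnormE bform0r.
have [_ /(_ x)] := psd_gram A; rewrite -/(bform _ x x) => h0 h.
by apply: sqnorm_eq0; have := sqnorm_ge0 x; lra.
Qed.

Lemma bform_bounded p (A : 'M[R]_p) :
  exists2 c, 0 < c & forall x, bform A x x <= c * sqnorm x.
Proof.
(* The summand 1 keeps the constant positive when [A = 0], since later arguments divide by it. *)
exists (1 + \sum_i \sum_j `|A i j|).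
  by apply: ltr_pwDl => //; do 2!apply: sumr_ge0 => ? _.
have le1 (x : 'cV[R]_p) i : (x i 0) ^+ 2 <= sqnorm x.
  rewrite /sqnorm (bigD1 i) //= lerDl; apply: sumr_ge0 => k _; exact: sqr_ge0.
move=> x; rewrite bformE mulrDl mul1r -[leLHS]add0r lerD ?sqnorm_ge0 //.
rewrite mulr_suml; apply: ler_sum => i _; rewrite mulr_suml.
apply: ler_sum => j _; apply: le_trans (ler_norm _) _; rewrite normrM.
apply: ler_wpM2l => //; rewrite ler_norml.
have := le1 x i; have := le1 x j.
have := sqr_ge0 (x i 0 - x j 0); have := sqr_ge0 (x i 0 + x j 0).
by rewrite sqrrB sqrrD => *; apply/andP; split; lra.
Qed.

(** With [c] bounding the form of the inverse, nonnegativity of the form of [A] at [c x - A^-1 x]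
    reads [c^2 A(x,x) - 2 c |x|^2 + A^-1(x,x) >= 0], whence [c A(x,x) >= |x|^2]. *)
Lemma psd_unit_coercive p (A : 'M[R]_p) : psd A -> A \in unitmx ->
  exists2 c, 0 < c & forall x, c * sqnorm x <= bform A x x.
Proof.
move=> /psdP[sA pA] uA; have [c c0 cP] := bform_bounded (invmx A).
exists c^-1; rewrite ?invr_gt0 // => x.
have := pA (c *: x - invmx A *m x).
rewrite -scaleN1r !(bformDl, bformDr, bformZl, bformZr).
rewrite (bform_sym _ (invmx A *m x) sA) -bformMr mulmxV // -sqnormE.
rewrite -(bformMr A) mulmxV //.
have -> : bform 1%:M (invmx A *m x) x = bform (invmx A) x x.
  by rewrite -[in RHS](mulmx1 (invmx A)) bformMl trmx_inv sA.
move=> h; have := cP x => h2; rewrite ler_pdivrMl // -(ler_pM2l c0).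
by lra.
Qed.

Lemma psd_unit_gt0 p (A : 'M[R]_p) x :
  psd A -> A \in unitmx -> bform A x x = 0 -> x = 0.
Proof. by move=> pA uA /(psd_ker pA) Ax; rewrite -[x](mulKmx uA) Ax mulmx0. Qed.

Lemma psd_invmx p (A : 'M[R]_p) : psd A -> A \in unitmx -> psd (invmx A).
Proof.
move=> /psdP[sA pA] uA; apply/psdP; split=> [|x]; first by rewrite trmx_inv sA.
have -> : bform (invmx A) x x = bform A (invmx A *m x) (invmx A *m x).
  by rewrite -(bformMr A) mulmxV // bform_sym ?trmx1 // -bformMr mul1mx.
exact: pA.
Qed.

Lemma psdD p (A B : 'M[R]_p) : psd A -> psd B -> psd (A + B).
Proof.
move=> /psdP[sA pA] /psdP[sB pB]; apply/psdP; split=> [|x].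
  by rewrite linearD /= sA sB.
by rewrite bformD addr_ge0.
Qed.

Lemma psd0 p : psd (0 : 'M[R]_p).
Proof.
by apply/psdP; split=> [|x]; rewrite ?trmx0 // bform0.
Qed.

Lemma psd1 p : psd (1%:M : 'M[R]_p).
Proof.
by apply/psdP; split=> [|x]; rewrite ?trmx1 // -sqnormE sqnorm_ge0.
Qed.

Lemma psd_tr_ge0 p (A : 'M[R]_p) : psd A -> 0 <= \tr A.
Proof. by move=> /psdP[_ pA]; rewrite tr_bform; apply: sumr_ge0. Qed.

Lemma gram_eq0 p q (A : 'M[R]_(p, q)) : A *m A^T = 0 -> A = 0.
Proof.
move=> A0; apply: trmx_inj; rewrite trmx0; apply/matrixP => i j.
have : sqnorm (A^T *m delta_mx j 0) = 0.
  by rewrite sqnorm_mul trmxK A0 bform_delta mxE.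
by move=> /sqnorm_eq0/matrixP/(_ i 0); rewrite -colE !mxE.
Qed.

(** The trace is the sum of the positive definite form over the columns of [Z]. It turns a completed
    square of zero trace into an equality of matrices. *)
Lemma tr_gram_eq0 p q (A : 'M[R]_q) (Z : 'M[R]_(q, p)) :
  psd A -> A \in unitmx -> \tr (Z^T *m A *m Z) = 0 -> Z = 0.
Proof.
move=> pA uA; rewrite tr_bform => /eqP.
have E i : bform (Z^T *m A *m Z) (delta_mx i 0) (delta_mx i 0) =
    bform A (col i Z) (col i Z).
  by rewrite bformMr bformMl trmxK -!colE.
under eq_bigr do rewrite E.
have [_ pA'] := pA; rewrite psumr_eq0; last by move=> i _; exact: pA'.
move=> /allP h; apply/matrixP => i j.
have /implyP/(_ isT)/eqP/(psd_unit_gt0 pA uA) := h j (mem_index_enum _).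
by move/matrixP/(_ i 0); rewrite !mxE.
Qed.

End QuadraticForms.

(** * Resolvents and the multiplier of the Wasserstein constraint *)

Section Resolvent.
Variable R : realType.
Implicit Types (p q N : nat) (mu rho : R).

(** Parametrised by the inverse multiplier [mu], so that [mu = 0] is a regular point with value the
    identity. *)
Definition resolvent p (S : 'M[R]_p) mu := invmx (1%:M - mu *: S).

Lemma sym_sub_scale p (S : 'M[R]_p) mu : S^T = S -> (1%:M - mu *: S)^T = 1%:M - mu *: S.
Proof. by move=> sS; rewrite linearB linearZ /= trmx1 sS. Qed.

Lemma resolvent_sym p (S : 'M[R]_p) mu : S^T = S -> (resolvent S mu)^T = resolvent S mu.
Proof. by move=> sS; rewrite /resolvent trmx_inv sym_sub_scale. Qed.

Lemma resolvent_mulr p (S : 'M[R]_p) mu : 1%:M - mu *: S \in unitmx ->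
  mu *: (S *m resolvent S mu) = resolvent S mu - 1%:M.
Proof.
by move=> /mulmxV <-; rewrite mulmxBl mul1mx -scalemxAl opprB addrC subrK.
Qed.

Lemma resolvent_mull p (S : 'M[R]_p) mu : 1%:M - mu *: S \in unitmx ->
  mu *: (resolvent S mu *m S) = resolvent S mu - 1%:M.
Proof.
by move=> /mulVmx <-; rewrite mulmxBr mulmx1 -scalemxAr opprB addrC subrK.
Qed.

(** * The worst-case gain of a fixed error operator *)

Section Shift.
Variables (p N : nat) (T : 'M[R]_(p, N)) (mu : R).
Let S := T *m T^T.
Let M := T^T *m T.
Hypothesis uS : 1%:M - mu *: S \in unitmx.

(* The worst-case perturbation of a sample [y] is [wc_gain *m y]. *)
Definition wc_gain : 'M[R]_N := mu *: (T^T *m resolvent (T *m T^T) mu *m T).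

Let symS : S^T = S. Proof. by rewrite trmx_mul trmxK. Qed.
Let symM : M^T = M. Proof. by rewrite trmx_mul trmxK. Qed.

Lemma wc_gain_sym : wc_gain^T = wc_gain.
Proof.
by rewrite /wc_gain linearZ /= !trmx_mul trmxK (resolvent_sym _ symS) mulmxA.
Qed.

(** The resolvent identity [mu S R = R - 1] sandwiched between [T^T] and [T]. *)
Lemma mul_gram_wc_gain : mu *: (M *m wc_gain) = wc_gain - mu *: M.
Proof.
rewrite /wc_gain -scalemxAr -scalerBr; congr (_ *: _).
rewrite /M !mulmxA -(mulmxA _ T) -/S -(mulmxA _ S) scalemxAl scalemxAr.
by rewrite resolvent_mulr // mulmxBr mulmxBl mulmx1.
Qed.

Lemma mul_wc_gain_gram : mu *: (wc_gain *m M) = wc_gain - mu *: M.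
Proof.
have := congr1 trmx mul_gram_wc_gain.
by rewrite linearB /= wc_gain_sym [(mu *: M)^T]linearZ linearZ /= trmx_mul
  wc_gain_sym symM.
Qed.

(** Transfers invertibility from [1 - mu S], of size [p], to [1 - mu M], of size [N], and identifies
    the inverse as identity plus gain. *)
Lemma mul_resolvent_gram : (1%:M - mu *: M) *m (1%:M + wc_gain) = 1%:M.
Proof.
rewrite mulmxDr mulmx1 mulmxBl mul1mx -scalemxAl mul_gram_wc_gain.
by rewrite subKr subrK.
Qed.

Lemma gram_unitmx : 1%:M - mu *: M \in unitmx.
Proof. by have [] := mulmx1_unit mul_resolvent_gram. Qed.

Lemma invmx_gram : invmx (1%:M - mu *: M) = 1%:M + wc_gain.
Proof. by rewrite -[RHS](mulKmx gram_unitmx) mul_resolvent_gram mulmx1. Qed.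

Lemma tr_wc_gain : \tr wc_gain = \tr (resolvent S mu) - p%:R.
Proof.
by rewrite /wc_gain -(mulmxA T^T) linearZ /= mxtrace_mulC -mxtraceZ -mulmxA
  resolvent_mull // linearB /= mxtrace1.
Qed.

(** By cyclicity of the trace, the squared transport cost of the gain depends only on the small Gram
    matrix [S]. *)
Lemma tr_wc_gain_sqr :
  \tr (wc_gain^T *m wc_gain) = \tr ((resolvent S mu - 1%:M) *m (resolvent S mu - 1%:M)).
Proof.
rewrite wc_gain_sym /wc_gain -scalemxAr -scalemxAl scalerA mxtraceZ.
rewrite -[in RHS]resolvent_mull // -scalemxAr -scalemxAl scalerA mxtraceZ.
congr (_ * _); rewrite -(mulmxA T^T) -[in LHS]mulmxA mxtrace_mulC.
by rewrite /S !mulmxA.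
Qed.

(* Completion of the square in [u] for the Lagrangian of the inner problem. *)
Lemma lagrangian_square k (u y : 'M[R]_(N, k)) :
  u^T *m u + y^T *m wc_gain *m y - mu *: ((u + y)^T *m M *m (u + y)) =
  (u - wc_gain *m y)^T *m (1%:M - mu *: M) *m (u - wc_gain *m y).
Proof.
(* From here on only the symmetry of [V] and [mu M V = V - mu M = mu V M] matter. *)
move: wc_gain wc_gain_sym mul_gram_wc_gain mul_wc_gain_gram => V symV MV VM.
have E1 : (1%:M - mu *: M) *m (u - V *m y) = u - mu *: (M *m (u + y)).
  rewrite mulmxBr !mulmxBl !mul1mx -!scalemxAl mulmxA
    (scalemxAl mu (M *m V)) MV.
  rewrite mulmxBl -scalemxAl mulmxDr scalerDr.
  move: (mu *: (M *m u)) (mu *: (M *m y)) (V *m y) => a b c.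
  by apply/matrixP => i j; rewrite !mxE; ring.
have E2 z : mu *: (y^T *m V *m (M *m z)) =
    y^T *m V *m z - mu *: (y^T *m M *m z).
  rewrite mulmxA -(mulmxA y^T) scalemxAl scalemxAr VM.
  by rewrite mulmxBr mulmxBl -scalemxAr -scalemxAl.
rewrite -[RHS]mulmxA E1 [(u - V *m y)^T]linearB /= trmx_mul symV mulmxBl !mulmxBr.
rewrite -!scalemxAr E2 [(u + y)^T]linearD /= !mulmxDl !mulmxDr !scalerDr !mulmxA.
move: (u^T *m u) (y^T *m V *m y) (y^T *m V *m u) => a b c.
move: (mu *: (u^T *m M *m u)) (mu *: (u^T *m M *m y)) => d e.
move: (mu *: (y^T *m M *m u)) (mu *: (y^T *m M *m y)) => f g.
by apply/matrixP => i j; rewrite !mxE; ring.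
Qed.

End Shift.

(** Adding [|u - mu w|^2 >= 0], where [w = T^T T u], to [mu] times the form of [1 - mu T T^T] at
    [T u] leaves exactly [|u|^2 - mu |T u|^2 >= 0]. *)
Lemma psd_gram_swap p N (T : 'M[R]_(p, N)) mu : 0 <= mu ->
  psd (1%:M - mu *: (T *m T^T)) -> psd (1%:M - mu *: (T^T *m T)).
Proof.
move=> mu0 [_ pS]; apply/psdP; split.
  by apply: sym_sub_scale; rewrite trmx_mul trmxK.
move=> u; have := pS (T *m u); rewrite -!/(bform _ _ _) => h.
have := sqnorm_ge0 (u - mu *: (T^T *m (T *m u))).
rewrite sqnormE -scaleN1r !(bformDl, bformDr, bformZl, bformZr).
set w := T^T *m (T *m u); rewrite (bform_sym u w (trmx1 _ _)) -sqnormE.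
have -> : bform 1%:M u w = sqnorm (T *m u).
  by rewrite /w -!bformMr mul1mx -sqnorm_mul.
have -> : bform 1%:M w w = bform (T *m T^T) (T *m u) (T *m u).
  by rewrite -sqnormE sqnorm_mul trmxK.
move: h; rewrite !bformB !bformZ -!sqnormE -sqnorm_mul => h1 h2.
have := mulr_ge0 mu0 h1; lra.
Qed.

Lemma psd_wc_gain p N (T : 'M[R]_(p, N)) mu : 0 <= mu ->
  psd (1%:M - mu *: (T *m T^T)) -> 1%:M - mu *: (T *m T^T) \in unitmx ->
  psd (wc_gain T mu).
Proof.
move=> mu0 pS uS; apply/psdP; split=> [|x]; first exact: wc_gain_sym.
have /psdP[_ pR] := psd_invmx pS uS.
by rewrite /wc_gain bformZ mulr_ge0 // bformMr bformMl trmxK.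
Qed.

(** Cauchy-Schwarz on each row; the trace is the squared Frobenius norm. *)
Lemma sqnorm_mul_le p q (Z : 'M[R]_(p, q)) v :
  sqnorm (Z *m v) <= \tr (Z^T *m Z) * sqnorm v.
Proof.
rewrite mxtrace_mulC mulr_suml; apply: ler_sum => i _.
set a := (row i Z)^T.
have -> : (Z *m v) i 0 = bform 1%:M a v.
  by rewrite /bform trmxK mulmx1 -row_mul [RHS]mxE.
have -> : (Z *m Z^T) i i = sqnorm a.
  by rewrite mxE; apply: eq_bigr => k _; rewrite !mxE expr2.
(* Expanding gives [|v|^2 (|a|^2 |v|^2 - <a,v>^2) >= 0]; the factor [|v|^2] is cancelled below, so
   [v = 0] is treated apart. *)
have := sqnorm_ge0 (sqnorm v *: a - bform 1%:M a v *: v).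
rewrite [X in 0 <= X]sqnormE -scaleN1r !(bformDl, bformDr, bformZl, bformZr).
rewrite (bform_sym a v (trmx1 _ _)) -!sqnormE.
have [v0|vN0] := eqVneq (sqnorm v) 0.
  by rewrite (sqnorm_eq0 v0) -(scale0r v) !bformZr !mul0r expr0n /= mulr_ge0 ?sqnorm_ge0.
have vp : 0 < sqnorm v by rewrite lt_def vN0 sqnorm_ge0.
move=> h; rewrite -(ler_pM2l vp); nra.
Qed.

(** * The range of the multiplier and the equation fixing it *)

Definition admissible p (S : 'M[R]_p) := [set mu | 0 <= mu /\ psd (1%:M - mu *: S)].

(** The number [m] is the supremum of the admissible set, that is, the inverse of the largest
    eigenvalue of [S]; it is obtained without spectral theory. *)
Lemma sup_admissible p (S : 'M[R]_p) : psd S -> S != 0 ->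
  exists2 m, 0 < m & 1%:M - m *: S \notin unitmx /\
    forall mu, 0 <= mu < m -> psd (1%:M - mu *: S) /\ 1%:M - mu *: S \in unitmx.
Proof.
move=> pS0; have /psdP[sS pS] := pS0; move=> SN0.
have form mu x : bform (1%:M - mu *: S) x x = sqnorm x - mu * bform S x x.
  by rewrite bformB bformZ -sqnormE.
have psdE mu : (forall x, 0 <= sqnorm x - mu * bform S x x) ->
    psd (1%:M - mu *: S).
  move=> h; apply/psdP; split=> [|x]; first exact: sym_sub_scale.
  by rewrite form.
have [x0 x0p] : exists x, 0 < bform S x x.
  apply: contrapT => /forallNP h; move/negP: SN0; apply; apply/eqP.
  apply/matrixP => i j.
  have /(psd_ker pS0) : bform S (delta_mx j 0) (delta_mx j 0) = 0.
    by apply/eqP; rewrite eq_le pS andbT leNgt; apply/negP/h.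
  by move/matrixP/(_ i 0); rewrite -colE !mxE.
have supE : has_sup (admissible S).
  split; first by exists 0; split=> //; apply: psdE => x; rewrite mul0r subr0 sqnorm_ge0.
  exists (sqnorm x0 / bform S x0 x0) => mu [_ /psdP[_ /(_ x0)]].
  by rewrite form ler_pdivlMr // subr_ge0.
set m := sup (admissible S).
have m0 : 0 <= m.
  apply: ub_le_sup; first exact: supE.2.
  by split=> //; apply: psdE => x; rewrite mul0r subr0 sqnorm_ge0.
(* The supremum is itself admissible: a violation at some [x] would persist for multipliers slightly
   below [m]. *)
have pm x : 0 <= sqnorm x - m * bform S x x.
  rewrite leNgt; apply/negP => h.
  have s0 : 0 < bform S x x.
    by have := pS x; rewrite le_eqVlt => /predU1P[s0|//]; move: h;
      rewrite -s0 mulr0 subr0 ltNge sqnorm_ge0.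
  have e0 : 0 < m - sqnorm x / bform S x x.
    by rewrite subr_gt0 ltr_pdivrMr //; lra.
  have [mu [_ /psdP[_ /(_ x)]]] := sup_adherent e0 supE.
  by rewrite form -/m subKr ltr_pdivrMr // subr_ge0 => h1; rewrite ltNge h1.
have nu : 1%:M - m *: S \notin unitmx.
  (* If [1 - m S] were invertible it would be coercive with some constant [c]; with [d] bounding the
     form of [S], [m + c / d] would still be admissible. *)
  apply/negP => u; have [c c0 cP] := psd_unit_coercive (psdE _ pm) u.
  have [d d0 dP] := bform_bounded S.
  have : m + c / d <= m.
    apply: ub_le_sup; first exact: supE.2.
    have cd : 0 < c / d by rewrite divr_gt0.
    split; first by lra.
    apply: psdE => x; have := cP x; rewrite form.
    have : c / d * bform S x x <= c / d * (d * sqnorm x) by rewrite ler_pM2l.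
    by rewrite mulrA mulfVK ?gt_eqF //; lra.
  by rewrite gerDl leNgt divr_gt0.
have m1 : 0 < m.
  by rewrite lt_def m0 andbT; apply/eqP => mE; move: nu; rewrite mE scale0r subr0 unitmx1.
exists m => //; split=> // mu /andP[mu0 mum].
split.
  apply: psdE => x; have := pm x.
  have : mu * bform S x x <= m * bform S x x by rewrite ler_wpM2r // ltW.
  lra.
(* A kernel vector satisfies [|x|^2 = mu S(x,x)], while [|x|^2 >= m S(x,x)] and [mu < m]; hence
   [S(x,x) = 0] and [x = 0]. *)
apply: ker0_unitmx => x Ax.
have : bform (1%:M - mu *: S) x x = 0 by rewrite /bform -mulmxA Ax mulmx0 mxE.
rewrite form => fx; apply: sqnorm_eq0; have := pm x; have := pS x; move=> s0 pmx.
have s1 : (m - mu) * bform S x x <= 0 by lra.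
have : bform S x x <= 0 by rewrite -(pmulr_rle0 _ (_ : 0 < m - mu)) // subr_gt0.
move=> s2; have s3 : bform S x x = 0 by apply/eqP; rewrite eq_le s2.
by move: fx; rewrite s3 mulr0 subr0.
Qed.

(** A kernel vector of [1 - m S] is an eigenvector of [1 - mu S] with eigenvalue [1 / (1 + rho)],
    hence of [R - 1] with eigenvalue [rho]; the Frobenius norm dominates it. *)
Lemma resolvent_near_singular p (S : 'M[R]_p) m rho : 0 < m -> 0 < rho ->
  1%:M - m *: S \notin unitmx ->
  let mu := m * (rho / (1 + rho)) in
  S^T = S -> 1%:M - mu *: S \in unitmx ->
  rho ^+ 2 <= \tr ((resolvent S mu - 1%:M) *m (resolvent S mu - 1%:M)).
Proof.
move=> m0 rho0 nu mu sS u.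
have [v vN0 vE] : exists2 v : 'cV[R]_p, v != 0 & (1%:M - m *: S) *m v = 0.
  apply: contrapT => h; move/negP: nu; apply; apply: ker0_unitmx => x xE.
  by apply: contrapT => /eqP x0; apply: h; exists x.
set t := rho / (1 + rho).
have rN0 : 1 + rho != 0 by rewrite gt_eqF //; lra.
have Sv : m *: (S *m v) = v.
  by apply/eqP; rewrite eq_sym -subr_eq0 scalemxAl -{1}(mul1mx v) -mulmxBl vE.
have Av : (1%:M - mu *: S) *m v = (1 + rho)^-1 *: v.
  rewrite mulmxBl mul1mx -scalemxAl /mu mulrC -scalerA Sv -{1}(scale1r v) -scalerBl.
  by congr (_ *: _); rewrite /t; field.
have Rv : (resolvent S mu - 1%:M) *m v = rho *: v.
  have : resolvent S mu *m v = (1 + rho) *: v.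
    rewrite -[in RHS](mulKmx u v) Av -scalemxAr scalerA mulfV //.
    by rewrite scale1r.
  by rewrite mulmxBl => ->; rewrite mul1mx scalerDl scale1r addrAC subrr add0r.
have := sqnorm_mul_le (resolvent S mu - 1%:M) v.
rewrite Rv [(resolvent S mu - 1%:M)^T]linearB /= trmx1 resolvent_sym //.
rewrite [X in X <= _]sqnormE bformZl bformZr mulrA -expr2 -sqnormE.
rewrite ler_pM2r // lt_def sqnorm_ge0 andbT; apply/eqP => /sqnorm_eq0 v0.
by rewrite v0 eqxx in vN0.
Qed.

Lemma adj_eq p (A : 'M[R]_p) : A \in unitmx -> \adj A = \det A *: invmx A.
Proof.
move=> uA; rewrite -[LHS](mulmxK uA) mul_adj_mx mul_scalar_mx //.
Qed.

(** Intermediate value theorem between [0], where the trace is 0, and the point of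
    [resolvent_near_singular]. Clearing denominators by the squared determinant reduces continuity
    to that of a polynomial. *)
Lemma exists_multiplier p (S : 'M[R]_p) rho : psd S -> S != 0 -> 0 < rho ->
  exists mu, [/\ 0 < mu, psd (1%:M - mu *: S), 1%:M - mu *: S \in unitmx &
    \tr ((resolvent S mu - 1%:M) *m (resolvent S mu - 1%:M)) = rho ^+ 2].
Proof.
move=> pS SN0 rho0; have [m m0 [nu mP]] := sup_admissible pS SN0.
pose P : 'M[{poly R}]_p := 1%:M - 'X *: map_mx polyC S.
(* At a regular [mu], the matrix [Z] evaluates to the determinant times [R - 1]. *)
pose Z := \adj P - (\det P)%:M.
pose q := \tr (Z *m Z) - (rho ^+ 2)%:P * (\det P) ^+ 2.
pose h mu := \tr ((resolvent S mu - 1%:M) *m (resolvent S mu - 1%:M)).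
have evP mu : map_mx (horner_eval mu) P = 1%:M - mu *: S.
  rewrite map_mxB map_mx1 map_mxZ /=; congr (_ - _ *: _).
    by rewrite /horner_eval hornerX.
  by apply/matrixP => i j; rewrite !mxE /horner_eval hornerC.
have evq mu : 1%:M - mu *: S \in unitmx ->
    q.[mu] = \det (1%:M - mu *: S) ^+ 2 * (h mu - rho ^+ 2).
  move=> u; rewrite /q hornerD hornerN hornerM hornerC horner_exp.
  have -> : (\det P).[mu] = \det (1%:M - mu *: S).
    by rewrite -[LHS]/(horner_eval mu (\det P)) -det_map_mx evP.
  have -> : (\tr (Z *m Z)).[mu] = \tr (map_mx (horner_eval mu) (Z *m Z)).
    by rewrite trace_map_mx.
  rewrite map_mxM map_mxB map_mx_adj map_scalar_mx /= -det_map_mx evP.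
  rewrite adj_eq // -(scalemx1 _ (\det _)) -scalerBr -scalemxAl -scalemxAr scalerA mxtraceZ.
  by rewrite /h /resolvent; ring.
have mu1 : 0 <= m * (rho / (1 + rho)) < m.
  have r1 : 0 < 1 + rho by lra.
  rewrite mulr_ge0 ?divr_ge0 ?ltW //=.
  by rewrite gtr_pMr // ltr_pdivrMr // mul1r; lra.
have [mu1_ge0 _] := andP mu1; have [_ u1] := mP _ mu1.
have [_ u0] : psd (1%:M - 0 *: S) /\ 1%:M - 0 *: S \in unitmx.
  by apply: mP; rewrite lexx.
have h0 : h 0 = 0.
  by rewrite /h /resolvent scale0r subr0 invmx1 subrr mul0mx mxtrace0.
have [|mu /andP[mu_ge0 mu_le] /rootP qmu] := @Num.Theory.poly_ivt _ q 0 _ mu1_ge0.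
  rewrite !evq // h0 sub0r mulrN oppr_le0.
  rewrite mulr_ge0 ?sqr_ge0 //= mulr_ge0 ?sqr_ge0 // subr_ge0.
  by apply: resolvent_near_singular => //; case: pS.
have muI : 0 <= mu < m.
  by rewrite mu_ge0 (le_lt_trans mu_le); case/andP: mu1.
have [pmu umu] := mP _ muI.
have hmu : h mu = rho ^+ 2.
  move: qmu; rewrite evq // => /eqP; rewrite mulf_eq0 expf_eq0 /= subr_eq0.
  by move: umu; rewrite unitmxE unitfE => /negbTE -> /eqP.
(* The root is not 0, because the trace vanishes there whereas [rho ^+ 2] does not. *)
exists mu; split=> //; rewrite lt_def mu_ge0 andbT.
apply/eqP => mu_eq0; move: hmu; rewrite mu_eq0 h0 => /esym/eqP.
by rewrite expf_eq0 /= gt_eqF.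
Qed.
End Resolvent.

(** * The linear matrix inequality *)

Section LMI.
Variables (R : realType) (p q : nat).
Implicit Types (g : R) (X : 'M[R]_p).
Variables (C : 'M[R]_p) (E : 'M[R]_(p, q)) (G : 'M[R]_q).
Hypotheses (symC : C^T = C) (symG : G^T = G) (uG : G \in unitmx)
  (pG : psd (invmx G)).

(** The constraint matrix of the program with [C], [E], [G] standing for [TTcirc], [K - Kcirc] and
    [1 + H H^T]. *)
Definition lmi X g : 'M[R]_(p + (p + q)) :=
  block_mx X (row_mx (g%:M) 0) (col_mx (g%:M) 0)
    (block_mx (g%:M - C) E E^T (invmx G)).

(** Chosen so that [g - S] is the Schur complement of [invmx G] in the lower right block;
    [err_mx_gram] identifies it with the Gram matrix of the error operator. *)
Let S := C + E *m G *m E^T.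

Let symS : S^T = S.
Proof. by rewrite linearD /= symC !trmx_mul trmxK symG mulmxA. Qed.

Lemma lmi_sym X g : X^T = X -> (lmi X g)^T = lmi X g.
Proof.
move=> sX; rewrite /lmi !tr_block_mx tr_row_mx tr_col_mx sX trmxK !trmx0.
by rewrite tr_scalar_mx linearB /= tr_scalar_mx symC trmx_inv symG.
Qed.

(** Completion of the square in the last component [c]. *)
Lemma lmi_form X g a b c :
  bform (lmi X g) (col_mx a (col_mx b c)) (col_mx a (col_mx b c)) =
  bform X a a + 2 * g * bform 1%:M a b + bform (g%:M - S) b b
  + bform (invmx G) (c + G *m E^T *m b) (c + G *m E^T *m b).
Proof.
have -> : bform (lmi X g) (col_mx a (col_mx b c)) (col_mx a (col_mx b c)) =
  bform X a a + 2 * g * bform 1%:M a b + bform (g%:M - C) b b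
    + 2 * bform E b c + bform (invmx G) c c.
  rewrite {1}/bform /lmi -mulmxA mul_block_col mul_block_col.
  rewrite mul_row_col mul_col_mx add_col_mx !tr_col_mx !mul_row_col.
  rewrite !mul0mx !addr0 !mulmxDr !mulmxA.
  have addE (u v : 'M[R]_1) : (u + v) 0 0 = u 0 0 + v 0 0 by rewrite mxE.
  rewrite mulmx0 add0r !addE -!/(bform _ _ _) (bform_tr E^T) trmxK.
  rewrite !(bform_scalar g) (bform_sym a b (trmx1 _ _)); ring.
have EG : bform (invmx G) c (G *m E^T *m b) = bform E b c.
  by rewrite (bform_tr E) -bformMr mulmxA mulVmx // mul1mx.
have GG : bform (invmx G) (G *m E^T *m b) (G *m E^T *m b) =
    bform (E *m G *m E^T) b b.
  by rewrite /bform !trmx_mul trmxK symG -!mulmxA mulKmx.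
rewrite !(bformDl, bformDr) (bform_sym c); last by rewrite trmx_inv symG.
rewrite EG GG !bformB /S bformD; ring.
Qed.

(** Minimising the form over [c] and then over [b] leaves [X - g R] positive semidefinite, where [R]
    is the resolvent; only its trace is kept. *)
Lemma lmi_feasible_pos X g : 0 < g -> psd (lmi X g) ->
  [/\ psd (1%:M - g^-1 *: S), 1%:M - g^-1 *: S \in unitmx &
      g * \tr (resolvent S g^-1) <= \tr X].
Proof.
move=> g0 pL; have /psdP[_ pL'] := pL; have gN0 : g != 0 by rewrite gt_eqF.
have SE : g%:M - S = g *: (1%:M - g^-1 *: S).
  by rewrite scalerBr scalerA mulfV // scale1r scalemx1.
(* This last component is the minimiser: it cancels the square involving [invmx G]. *)
pose z a b := col_mx a (col_mx b (- (G *m E^T *m b))) : 'cV[R]_(p + (p + q)).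
have zE a b : bform (lmi X g) (z a b) (z a b) =
    bform X a a + 2 * g * bform 1%:M a b + g * bform (1%:M - g^-1 *: S) b b.
  rewrite lmi_form addNr SE bformZ.
  by rewrite bform0l addr0.
have uS : 1%:M - g^-1 *: S \in unitmx.
  (* For such [b] the vector [z 0 b] lies in the kernel of the whole matrix, and its first block row
     reads [g b = 0]. *)
  apply: ker0_unitmx => b Ab.
  have : bform (lmi X g) (z 0 b) (z 0 b) = 0.
    by rewrite zE !bform0l /bform -mulmxA Ab mulmx0 mxE !(mulr0, addr0).
  move/(psd_ker pL); rewrite mul_block_col mul_row_col mulmx0 mul0mx addr0 add0r.
  move/(congr1 usubmx); rewrite col_mxKu linear0 mul_scalar_mx.
  by move/eqP; rewrite scaler_eq0 (negbTE gN0) => /eqP.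
split=> //.
  apply/psdP; split=> [|b]; first exact: sym_sub_scale.
  by have := pL' (z 0 b); rewrite -/(bform _ _ _) zE !bform0l mulr0 !add0r pmulr_rge0.
set A := 1%:M - g^-1 *: S; set Q := resolvent S g^-1.
rewrite !tr_bform mulr_sumr; apply: ler_sum => i _.
set a := delta_mx i 0.
(* The minimiser in [b] is [- Q a]; the form then equals [X(a,a) - g Q(a,a)]. *)
have := pL' (z a (- (Q *m a))); rewrite -/(bform _ _ _) zE.
have -> : bform 1%:M a (- (Q *m a)) = - bform Q a a.
  by rewrite -scaleN1r bformZr -bformMr mul1mx mulN1r.
have -> : bform A (- (Q *m a)) (- (Q *m a)) = bform Q a a.
  rewrite -scaleN1r bformZl bformZr mulrA mulrNN !mul1r.
  by rewrite -bformMr mulmxV // bform_sym ?trmx1 // -bformMr mul1mx.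
lra.
Qed.

(** At [X = g Q] the terms in [a] and [b] collapse to [g A(Q a + b, Q a + b)], so the trace bound is
    attained. *)
Lemma lmi_resolvent g : 0 < g -> psd (1%:M - g^-1 *: S) ->
  1%:M - g^-1 *: S \in unitmx ->
  psd (g *: resolvent S g^-1) /\ psd (lmi (g *: resolvent S g^-1) g).
Proof.
move=> g0 pS uS; have gN0 : g != 0 by rewrite gt_eqF.
set A := 1%:M - g^-1 *: S; set Q := resolvent S g^-1.
have /psdP[symQ pQ] := psd_invmx pS uS; rewrite -/(resolvent S g^-1) -/Q in symQ pQ.
have symX : (g *: Q)^T = g *: Q by rewrite linearZ /= symQ.
have /psdP[_ pA] := pS; have /psdP[_ pJ] := pG.
split; apply/psdP; split; rewrite ?lmi_sym //.
  by move=> a; rewrite bformZ mulr_ge0 ?(ltW g0).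
move=> z; rewrite -(vsubmxK z) -(vsubmxK (dsubmx z)) lmi_form.
set a := usubmx z; set b := usubmx _; set c := dsubmx _.
rewrite addr_ge0 ?pJ //.
have SE : g%:M - S = g *: A.
  by rewrite /A scalerBr scalerA mulfV // scale1r scalemx1.
have := pA (Q *m a + b); rewrite -/(bform _ _ _) !(bformDl, bformDr).
rewrite SE !bformZ (bform_sym b); last by case: pS.
have -> : bform A b (Q *m a) = bform 1%:M a b.
  by rewrite -bformMr mulmxV // bform_sym ?trmx1.
have -> : bform A (Q *m a) (Q *m a) = bform Q a a.
  by rewrite -bformMr mulmxV // bform_sym ?trmx1 // -bformMr mul1mx.
move=> h; have := mulr_ge0 (ltW g0) h; lra.
Qed.

Lemma lmi_zero_feasible : S = 0 -> psd (lmi 0 0).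
Proof.
move=> S0; have /psdP[_ pJ] := pG; apply/psdP; split=> [|z].
  by apply: lmi_sym; rewrite trmx0.
rewrite -(vsubmxK z) -(vsubmxK (dsubmx z)) lmi_form S0 raddf0 subr0.
by rewrite !bform0 mulr0 mul0r !add0r pJ.
Qed.

End LMI.

(** A zero multiplier leaves [- S] as Schur complement, so a positive semidefinite [S] must vanish.
    This isolates the degenerate case of a zero error operator. *)
Lemma lmi_zero (R : realType) p q (C : 'M[R]_p) (E : 'M[R]_(p, q)) G X :
  G^T = G -> G \in unitmx -> psd (C + E *m G *m E^T) -> C^T = C ->
  psd (lmi C E G X 0) -> C + E *m G *m E^T = 0.
Proof.
move=> sG uG pS sC /psdP[_ pL]; apply/matrixP => i j; rewrite [RHS]mxE.
set S := C + _ in pS *.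
have /psdP[_ pS'] := pS; set b : 'cV[R]_p := delta_mx j 0.
have := pL (col_mx 0 (col_mx b (- (G *m E^T *m b)))).
rewrite -/(bform _ _ _) lmi_form // addNr !bform0l -/S raddf0.
rewrite sub0r bformN !(mulr0, add0r, addr0) oppr_ge0 => le0.
have /(psd_ker pS) : bform S b b = 0 by apply/eqP; rewrite eq_le le0 pS'.
by move/matrixP/(_ i 0); rewrite -colE !mxE.
Qed.

(** * The Gram matrix of the error operator as a function of the estimator *)

Section ErrorGram.
Variables (R : realType) (p q N : nat).
Variables (H : 'M[R]_(q, N)) (L : 'M[R]_(p, N)) (K : 'M[R]_(p, q)).

Let G := 1%:M + H *m H^T.

Lemma gram_sym : G^T = G.
Proof. by rewrite linearD /= trmx1 trmx_mul trmxK. Qed.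

(** Rewrites [TTcirc] with the same inverse as [Kcirc], so that the two can be combined. *)
Lemma invmx_woodbury :
  invmx (1%:M + H^T *m H) = 1%:M - H^T *m invmx G *m H.
Proof.
have uG : G \in unitmx := unitmx_add1_gram H.
have uF : 1%:M + H^T *m H \in unitmx.
  by have := unitmx_add1_gram H^T; rewrite trmxK.
have E : (1%:M + H^T *m H) *m (1%:M - H^T *m invmx G *m H) = 1%:M.
  have e : H *m H^T = G - 1%:M by rewrite /G addrC addKr.
  rewrite mulmxBr mulmx1 mulmxDl mul1mx !mulmxA -(mulmxA H^T H) e.
  rewrite mulmxBr mulmx1 !mulmxBl -(mulmxA H^T G) mulmxV // mulmx1.
  by rewrite addrCA subrr addr0 addrK.
by rewrite -[RHS](mulKmx uF) E mulmx1.
Qed.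

Lemma TTcirc_sym :
  (L *m invmx (1%:M + H^T *m H) *m L^T)^T = L *m invmx (1%:M + H^T *m H) *m L^T.
Proof.
by rewrite !trmx_mul !trmxK trmx_inv linearD /= trmx1 trmx_mul trmxK mulmxA.
Qed.

(* Completing the square in [K]. *)
Lemma err_mx_gram :
  L *m invmx (1%:M + H^T *m H) *m L^T
   + (K - L *m H^T *m invmx G) *m G *m (K - L *m H^T *m invmx G)^T
  = row_mx (K *m H - L) K *m (row_mx (K *m H - L) K)^T.
Proof.
have uG : G \in unitmx := unitmx_add1_gram H.
rewrite invmx_woodbury tr_row_mx mul_row_col !linearB /= !trmx_mul trmx_inv.
rewrite gram_sym !trmxK; set J := invmx G.
have -> : (K - L *m H^T *m J) *m G = K + K *m H *m H^T - L *m H^T.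
  by rewrite mulmxBl mulmxKV // /G mulmxDr mulmx1 mulmxA.
have e : H *m H^T = G - 1%:M by rewrite /G addrC addKr.
rewrite !(mulmxBr, mulmx1, mulmxBl, mulmxDl, mulmxA).
have -> : K *m H *m H^T *m J *m H *m L^T =
    K *m H *m L^T - K *m J *m H *m L^T.
  rewrite -(mulmxA K H) e mulmxBr mulmx1 mulmxBl -(mulmxA K G) mulmxV //.
  by rewrite mulmx1 !mulmxBl.
move: (K *m J *m H *m L^T) (K *m H *m H^T *m K^T) (K *m K^T) => a b c.
move: (L *m L^T) (L *m H^T *m J *m H *m L^T) => d f.
move: (K *m H *m L^T) (L *m H^T *m K^T) => g h.
by apply/matrixP => i j; rewrite !mxE; ring.
Qed.
End ErrorGram.

(** * Linear images and second moments *)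

Section Measurability.
Variable R : realType.

Lemma tvecK N : cancel (@vtup R N) (@tvec R N).
Proof. by move=> v; apply/matrixP => i j; rewrite mxE tnth_mktuple (ord1 j). Qed.

Lemma measurable_bform d (D : measurableType d) N (W : 'M[R]_N) (f : D -> 'cV[R]_N) :
  (forall i, measurable_fun setT (fun x => f x i 0)) ->
  measurable_fun setT (fun x => bform W (f x) (f x)).
Proof.
move=> mf; under eq_fun do rewrite bformE.
apply: measurable_sum => i; apply: measurable_sum => j.
apply: measurable_funM; first exact: measurable_cst.
by apply: measurable_funM.
Qed.

Lemma measurable_mulmx d (D : measurableType d) p N (A : 'M[R]_(p, N)) (f : D -> 'cV[R]_N) :
  (forall i, measurable_fun setT (fun x => f x i 0)) ->
  forall i, measurable_fun setT (fun x => (A *m f x) i 0).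
Proof.
move=> mf i; under eq_fun do rewrite mxE.
apply: measurable_sum => j; apply: measurable_funM => //.
Qed.

Lemma measurable_tvec N (i : 'I_N) :
  measurable_fun setT (fun x : N.-tuple R => tvec x i 0).
Proof. by under eq_fun do rewrite mxE; exact: measurable_tnth. Qed.

Definition lintup N (D : 'M[R]_N) (x : N.-tuple R) : N.-tuple R := vtup (D *m tvec x).

Lemma tvec_lintup N (D : 'M[R]_N) x : tvec (lintup D x) = D *m tvec x.
Proof. exact: tvecK. Qed.

Lemma measurable_lintup N (D : 'M[R]_N) : measurable_fun setT (lintup D).
Proof.
apply/measurable_fun_tnthP => i.
have -> : (@tnth N R)^~ i \o lintup D = fun x => (D *m tvec x) i 0.
  by apply/funext => x; rewrite /= tnth_mktuple.
exact: measurable_mulmx (@measurable_tvec N) i.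
Qed.

HB.instance Definition _ N (D : 'M[R]_N) :=
  isMeasurableFun.Build _ _ _ _ (lintup D) (measurable_lintup D).

(** The image of a law under this map is the deterministic coupling of its linear image with
    itself. *)
Definition lingraph N (D : 'M[R]_N) (x : N.-tuple R) := (lintup D x, x).

Lemma measurable_lingraph N (D : 'M[R]_N) : measurable_fun setT (lingraph D).
Proof. by apply: measurable_fun_pair; [exact: measurable_lintup|exact: measurable_id]. Qed.

HB.instance Definition _ N (D : 'M[R]_N) :=
  isMeasurableFun.Build _ _ _ _ (lingraph D) (measurable_lingraph D).

Definition linprob N (P : probability (N.-tuple R) R) (D : 'M[R]_N) :
    probability (N.-tuple R) R :=
  distribution P (lintup D).

Definition lincoupling N (P : probability (N.-tuple R) R) (D : 'M[R]_N) :
    probability (N.-tuple R * N.-tuple R)%type R :=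
  distribution P (lingraph D).

Lemma lincouplingP N (P : probability (N.-tuple R) R) (D : 'M[R]_N) :
  coupling (linprob P D) P (lincoupling P D).
Proof.
move=> A mA; split; rewrite /= /distribution /pushforward; congr (P _).
  by apply/seteqP; split => x //= [].
by apply/seteqP; split => x //= [].
Qed.

End Measurability.

(** * Quadratic integrals, linear images of the nominal law, and marginals of couplings *)

Section SecondMoments.
Variables (R : realType) (N : nat) (P0 : probability (N.-tuple R) R).
Hypothesis P0_moment : finite_second_moment P0.
Hypothesis P0_cov :
  forall i j, (\int[P0]_x (tnth x i * tnth x j)%:E = ((i == j)%:R)%:E)%E.

Lemma integrable_tnthM (P : probability (N.-tuple R) R) i j :
  finite_second_moment P ->
  P.-integrable setT (fun x => (tnth x i * tnth x j)%:E).
Proof.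
move=> mP.
have Ps : P.-integrable setT (fun x => (tnth x i ^+ 2)%:E + (tnth x j ^+ 2)%:E)%E.
  exact: (integrableD measurableT (mP i) (mP j)).
apply: (le_integrable measurableT _ _ Ps).
  by apply/measurable_EFinP; apply: measurable_funM; exact: measurable_tnth.
move=> x _; rewrite -EFinD /= lee_fin.
rewrite [leRHS]ger0_norm ?addr_ge0 ?sqr_ge0 // ler_norml.
have := sqr_ge0 (tnth x i - tnth x j); have := sqr_ge0 (tnth x i + tnth x j).
rewrite sqrrB sqrrD; have := sqr_ge0 (tnth x i); have := sqr_ge0 (tnth x j).
by move=> *; apply/andP; split; lra.
Qed.

Lemma bform_EFin (W : 'M[R]_N) x :
  (bform W (tvec x) (tvec x))%:E =
  (\sum_i \sum_j ((W i j)%:E * (tnth x i * tnth x j)%:E))%E.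
Proof.
rewrite bformE -sumEFin; apply: eq_bigr => i _; rewrite -sumEFin.
by apply: eq_bigr => j _; rewrite !mxE EFinM.
Qed.

Lemma integrable_bform (P : probability (N.-tuple R) R) (W : 'M[R]_N) :
  finite_second_moment P ->
  P.-integrable setT (fun x => (bform W (tvec x) (tvec x))%:E).
Proof.
move=> mP; under eq_fun do rewrite bform_EFin.
apply: integrable_sum => // i _; apply: integrable_sum => // j _.
by apply: integrableZl => //; exact: integrable_tnthM.
Qed.

(** Integrating entrywise against the identity second-moment matrix keeps only the diagonal of
    [W]. *)
Lemma integral_bform (W : 'M[R]_N) :
  (\int[P0]_x (bform W (tvec x) (tvec x))%:E = (\tr W)%:E)%E.
Proof.
under eq_integral do rewrite bform_EFin.
rewrite integral_sum //; last first.
  move=> i; apply: integrable_sum => // j _.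
  by apply: integrableZl => //; exact: integrable_tnthM.
rewrite -sumEFin; apply: eq_bigr => i _.
rewrite integral_sum //; last first.
  by move=> j; apply: integrableZl => //; exact: integrable_tnthM.
rewrite (bigD1 i) //= integralZl ?P0_cov //; last exact: integrable_tnthM.
rewrite eqxx mule1 big1 ?adde0 // => j ji.
rewrite integralZl ?P0_cov //; last exact: integrable_tnthM.
by rewrite eq_sym (negbTE ji) mule0.
Qed.

Lemma integral_linprob (D : 'M[R]_N) (f : N.-tuple R -> R) :
  measurable_fun setT f -> (forall x, 0 <= f x) ->
  (\int[linprob P0 D]_x (f x)%:E = \int[P0]_x (f (lintup D x))%:E)%E.
Proof.
move=> mf f0.
rewrite (ge0_integral_pushforward (measurable_lintup D)) ?preimage_setT //.
- exact/measurable_EFinP.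
- by move=> x _; rewrite lee_fin.
Qed.

Lemma cost_linprob p (A : 'M[R]_(p, N)) (D : 'M[R]_N) :
  cost (linprob P0 D) A = (\tr ((A *m D)^T *m (A *m D)))%:E.
Proof.
rewrite /cost integral_linprob.
- under eq_integral do rewrite tvec_lintup mulmxA sqnorm_mul.
  exact: integral_bform.
- under eq_fun do rewrite sqnorm_mul.
  exact: measurable_bform (@measurable_tvec R N).
- by move=> x; exact: sqnorm_ge0.
Qed.

(** The graph coupling competes in the infimum, and its cost is the integral of [|(D - 1) x|^2]. *)
Lemma W2sq_linprob (D : 'M[R]_N) :
  (W2sq (linprob P0 D) P0 <= (\tr ((D - 1%:M)^T *m (D - 1%:M)))%:E)%E.
Proof.
apply: ereal_inf_lbound; exists (lincoupling P0 D); first exact: lincouplingP.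
rewrite (ge0_integral_pushforward (measurable_lingraph D)) ?preimage_setT //.
- under eq_integral => x _ do
    rewrite /= tvec_lintup -{2}(mul1mx (tvec x)) -mulmxBl sqnorm_mul.
  exact: integral_bform.
- apply/measurable_EFinP; under eq_fun do rewrite sqnormE.
  apply: measurable_bform => i; under eq_fun do rewrite !mxE.
  apply: measurable_funB.
    exact: (measurableT_comp (measurable_tnth i) measurable_fst).
  exact: (measurableT_comp (measurable_tnth i) measurable_snd).
- by move=> x _; rewrite lee_fin sqnorm_ge0.
Qed.

Lemma finite_second_moment_linprob (D : 'M[R]_N) :
  finite_second_moment (linprob P0 D).
Proof.
move=> i; apply: (integrable_pushforward (measurable_lintup D)) => //.
- apply/measurable_EFinP; apply: measurable_funX; exact: measurable_tnth.
- rewrite preimage_setT.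
  (* The square of coordinate [i] of [D x] is the quadratic form of [D^T E_ii D], with [E_ii] the
     matrix unit. *)
  have := integrable_bform (D^T *m delta_mx i i *m D) P0_moment.
  congr (integrable _ _ _); apply/funext => x /=; congr (_%:E).
  rewrite bformMr bformMl trmxK -tvec_lintup bformE (bigD1 i) //=.
  rewrite (bigD1 i) //= !mxE !eqxx mul1r big1 => [|j ji].
    rewrite big1 ?addr0 // => j ji; apply: big1 => k _.
    by rewrite !mxE (negbTE ji) mul0r.
  by rewrite !mxE (negbTE ji) andbF mul0r.
Qed.

Lemma integral_marginal1 (P Q : probability (N.-tuple R) R) pi (f : N.-tuple R -> R) :
  coupling P Q pi -> measurable_fun setT f -> (forall x, 0 <= f x) ->
  (\int[pi]_z (f z.1)%:E = \int[P]_x (f x)%:E)%E.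
Proof.
move=> cpl mf f0.
have := @ge0_integral_pushforward _ _ _ _ R _ (@measurable_fst _ _ (N.-tuple R) (N.-tuple R)) pi setT
  (fun x => (f x)%:E) measurableT.
rewrite preimage_setT => <-.
- apply: eq_measure_integral => A mA _; transitivity (pi (A `*` setT)); last exact: (cpl A mA).1.
  by rewrite /= /pushforward; congr (pi _); apply/seteqP; split => x //= [].
- exact/measurable_EFinP.
- by move=> x _; rewrite lee_fin.
Qed.

Lemma integral_marginal2 (P Q : probability (N.-tuple R) R) pi (f : N.-tuple R -> R) :
  coupling P Q pi -> measurable_fun setT f -> (forall x, 0 <= f x) ->
  (\int[pi]_z (f z.2)%:E = \int[Q]_x (f x)%:E)%E.
Proof.
move=> cpl mf f0.
have := @ge0_integral_pushforward _ _ _ _ R _ (@measurable_snd _ _ (N.-tuple R) (N.-tuple R)) pi setT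
  (fun x => (f x)%:E) measurableT.
rewrite preimage_setT => <-.
- apply: eq_measure_integral => A mA _; transitivity (pi (setT `*` A)); last exact: (cpl A mA).2.
  by rewrite /= /pushforward; congr (pi _); apply/seteqP; split => x //= [].
- exact/measurable_EFinP.
- by move=> x _; rewrite lee_fin.
Qed.
End SecondMoments.

(** * Strong duality for a fixed estimator *)

Section InnerProblem.
Variables (R : realType) (p N : nat) (P0 : probability (N.-tuple R) R).
Variables (T : 'M[R]_(p, N)) (rho : R).
Hypothesis P0_moment : finite_second_moment P0.
Hypothesis P0_cov :
  forall i j, (\int[P0]_x (tnth x i * tnth x j)%:E = ((i == j)%:R)%:E)%E.

Let S := T *m T^T.

(** Here [mu] is the inverse of the multiplier; positive definiteness is encoded as semidefinite and
    invertible. *)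
Definition strictly_admissible mu :=
  [/\ 0 < mu, psd (1%:M - mu *: S) & 1%:M - mu *: S \in unitmx].

(** The Lagrange dual function of the inner maximisation at the multiplier [mu^-1]. *)
Definition dual_value mu := mu^-1 * (rho ^+ 2 + \tr (wc_gain T mu)).

(** The right-hand side is the objective of the program at [X = mu^-1 R]. *)
Lemma dual_valueE mu : strictly_admissible mu ->
  dual_value mu = mu^-1 * (rho ^+ 2 - p%:R) + mu^-1 * \tr (resolvent S mu).
Proof. by move=> [_ _ u]; rewrite /dual_value tr_wc_gain //; ring. Qed.

(** The gap between the two sides is [mu^-1] times the completed square at [u = x - y]. *)
Lemma sqnorm_le_lagrangian mu (x y : 'cV[R]_N) : strictly_admissible mu ->
  sqnorm (T *m x) <= mu^-1 * sqnorm (x - y) + mu^-1 * bform (wc_gain T mu) y y.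
Proof.
move=> [mu0 pS uS]; rewrite -mulrDr ler_pdivlMl // -subr_ge0.
have /psdP[_ pM] := psd_gram_swap (ltW mu0) pS.
have := pM (x - y - wc_gain T mu *m y).
have /matrixP/(_ 0 0) := lagrangian_square uS (x - y) y.
have entry (a b c : 'M[R]_1) : (a + b - mu *: c) 0 0 = a 0 0 + b 0 0 - mu * c 0 0.
  by rewrite !mxE.
have -> : sqnorm (x - y) = ((x - y)^T *m (x - y)) 0 0.
  by rewrite sqnormE /bform mulmx1.
by rewrite subrK entry -!/(bform _ _ _) sqnorm_mul => <-.
Qed.

(** Integrate the pointwise Lagrangian bound over a near-optimal coupling: the first term gives the
    transport cost, the second depends on the nominal marginal only. *)
Lemma weak_duality mu P : strictly_admissible mu -> wball P0 rho P ->
  (cost P T <= (dual_value mu)%:E)%E.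
Proof.
move=> smu [_ W2]; have [mu0 pS uS] := smu.
have /psdP[_ pV] := psd_wc_gain (ltW mu0) pS uS.
have mu1 : 0 <= mu^-1 by rewrite invr_ge0 ltW.
have mT : measurable_fun setT (fun x : N.-tuple R => sqnorm (T *m tvec x)).
  under eq_fun do rewrite sqnorm_mul.
  exact: measurable_bform (@measurable_tvec R N).
have mV : measurable_fun setT
    (fun x : N.-tuple R => bform (wc_gain T mu) (tvec x) (tvec x)).
  exact: measurable_bform (@measurable_tvec R N).
have mD : measurable_fun setT
    (fun z : N.-tuple R * N.-tuple R => sqnorm (tvec z.1 - tvec z.2)).
  under eq_fun do rewrite sqnormE.
  apply: measurable_bform => i; under eq_fun do rewrite !mxE.
  apply: measurable_funB.
    exact: (measurableT_comp (measurable_tnth i) measurable_fst).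
  exact: (measurableT_comp (measurable_tnth i) measurable_snd).
apply/lee_addgt0Pr => e e0.
(* The coupling exceeds the budget by less than [mu * e], which the multiplier [mu^-1] turns into
   [e]. *)
have eP : 0 < mu * e by rewrite mulr_gt0.
have /ereal_inf_lt[_ [pi cpl <-] lt_pi] : (W2sq P P0 < (rho ^+ 2 + mu * e)%:E)%E.
  by apply: le_lt_trans W2 _; rewrite lte_fin ltrDl.
rewrite /cost -(integral_marginal1 cpl mT) //; last by move=> x; exact: sqnorm_ge0.
apply: (@le_trans _ _ (\int[pi]_z ((mu^-1)%:E * (sqnorm (tvec z.1 - tvec z.2))%:E
   + (mu^-1)%:E * (bform (wc_gain T mu) (tvec z.2) (tvec z.2))%:E))%E).
  apply: ge0_le_integral => //.
  - by move=> z _; rewrite lee_fin sqnorm_ge0.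
  - apply/measurable_EFinP.
    exact: (measurableT_comp mT measurable_fst).
  - apply/measurable_EFinP; apply: measurable_funD; apply: measurable_funM => //.
    exact: (measurableT_comp mV measurable_snd).
  - by move=> z _; rewrite -!EFinM -EFinD lee_fin; exact: sqnorm_le_lagrangian.
have mV2 := measurableT_comp mV (@measurable_snd _ _ (N.-tuple R) (N.-tuple R)).
rewrite ge0_integralD //; last 4 first.
- by move=> z _; rewrite -EFinM lee_fin mulr_ge0 // sqnorm_ge0.
- by apply/measurable_EFinP; apply: measurable_funM.
- by move=> z _; rewrite -EFinM lee_fin mulr_ge0 // pV.
- by apply/measurable_EFinP; apply: measurable_funM.
rewrite !ge0_integralZl_EFin //; last 4 first.
- by move=> z _; rewrite lee_fin pV.
- exact/measurable_EFinP.
- by move=> z _; rewrite lee_fin sqnorm_ge0.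
- exact/measurable_EFinP.
rewrite (integral_marginal2 cpl mV) // integral_bform //.
have -> : ((dual_value mu)%:E + e%:E = (mu^-1)%:E * (rho ^+ 2 + mu * e)%:E
    + (mu^-1)%:E * (\tr (wc_gain T mu))%:E)%E.
  rewrite -!EFinM -!EFinD; congr (_%:E); rewrite /dual_value.
  by field; rewrite gt_eqF.
by rewrite leeD2r // lee_pmul2l ?lte_fin ?invr_gt0 // ltW.
Qed.

Lemma linprob_optimal mu : strictly_admissible mu ->
  \tr ((wc_gain T mu)^T *m wc_gain T mu) = rho ^+ 2 ->
  wball P0 rho (linprob P0 (1%:M + wc_gain T mu)) /\
  cost (linprob P0 (1%:M + wc_gain T mu)) T = (dual_value mu)%:E.
Proof.
move=> [mu0 _ uS] tV; split.
  split; first exact: finite_second_moment_linprob.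
  by apply: le_trans (W2sq_linprob _ _ _) _ => //; rewrite addrC addKr tV.
rewrite cost_linprob //; congr (_%:E).
(* With [y] the identity matrix and [u = V], the argument [u - V y] of the square is zero, so the
   trace of the Lagrangian bound is an equality. *)
have := congr1 mxtrace (lagrangian_square uS (wc_gain T mu) 1%:M).
rewrite /dual_value; move: (wc_gain T mu) tV => V tV.
rewrite trmx1 mul1mx !mulmx1 subrr mulmx0 mxtrace0 !mxtraceD [\tr (- _)]raddfN /= mxtraceZ tV.
rewrite (addrC V) !trmx_mul -!mulmxA => /eqP; rewrite subr_eq0 => /eqP ->.
by rewrite mulKf // gt_eqF.
Qed.

(** Evaluate the square for [mu] at the gain of [nu]: since the latter attains the common dual
    value, the trace of the square is zero, and positive definiteness of [1 - mu M] equates the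
    gains. *)
Lemma wc_gain_unique mu nu : strictly_admissible mu -> strictly_admissible nu ->
  \tr ((wc_gain T nu)^T *m wc_gain T nu) = rho ^+ 2 ->
  dual_value mu = dual_value nu -> wc_gain T mu = wc_gain T nu.
Proof.
move=> [mu0 pS uS] snu tV vE; have [nu0 _ uSn] := snu.
have pM := psd_gram_swap (ltW mu0) pS; have uM := gram_unitmx uS.
apply/esym/eqP; rewrite -subr_eq0; apply/eqP/(tr_gram_eq0 pM uM).
have := congr1 mxtrace (lagrangian_square uS (wc_gain T nu) 1%:M).
have [_] := linprob_optimal snu tV; rewrite cost_linprob // => -[].
rewrite -vE /dual_value; move: (wc_gain T mu) (wc_gain T nu) tV => V W tW.
rewrite trmx1 mul1mx !mulmx1 (addrC W) !trmx_mul -!mulmxA => cE <-.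
rewrite !mxtraceD [\tr (- _)]raddfN /= mxtraceZ tW cE mulrA.
by rewrite divff ?gt_eqF // mul1r subrr.
Qed.

Lemma wball_nonempty : exists2 P, wball P0 rho P & (0 <= cost P T)%E.
Proof.
(* The nominal law, written as an image under the identity so that the linear transport bound
   applies. *)
exists (linprob P0 1%:M).
  split; first exact: finite_second_moment_linprob.
  apply: le_trans (W2sq_linprob _ _ _) _ => //.
  by rewrite subrr mulmx0 mxtrace0 lee_fin sqr_ge0.
by apply: integral_ge0 => x _; rewrite lee_fin sqnorm_ge0.
Qed.

Lemma exists_strictly_admissible : 0 < rho -> S != 0 ->
  exists2 mu, strictly_admissible mu &
    \tr ((wc_gain T mu)^T *m wc_gain T mu) = rho ^+ 2.
Proof.
move=> rho0 SN0; have [mu [mu0 pS uS tE]] := exists_multiplier (psd_gram T) SN0 rho0.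
by exists mu; [split|rewrite tr_wc_gain_sqr].
Qed.

End InnerProblem.

(** * From duality for a fixed estimator to the semidefinite program *)

Section SDP.
Variables (R : realType) (n dw dy ds T : nat).
Variables (A : 'M[R]_n) (B : 'M[R]_(n, dw)) (Cy : 'M[R]_(dy, n)) (Cs : 'M[R]_(ds, n)).
Variables (P0 : probability ((n + T.-1 * dw + T * dy)%N.-tuple R) R) (rho : R).
Hypothesis rho0 : 0 < rho.
Hypothesis P0_moment : finite_second_moment P0.
Hypothesis P0_cov :
  forall i j, (\int[P0]_x (tnth x i * tnth x j)%:E = ((i == j)%:R)%:E)%E.

Local Notation feasible := (sdp_feasible A B Cy Cs).
Local Notation TK := (@TK R n dw dy ds T A B Cy Cs).
Local Notation worst := (worst_cost A B Cy Cs P0 rho).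
Local Notation G := (1%:M + HT T A B Cy *m (HT T A B Cy)^T).

Implicit Types (K : 'M[R]_(T * ds, T * dy)) (g : R) (X : 'M[R]_(T * ds)).

Let uG : G \in unitmx. Proof. exact: unitmx_add1_gram. Qed.
Let symG : G^T = G. Proof. exact: gram_sym. Qed.
Let pG : psd (invmx G).
Proof. by apply: psd_invmx => //; apply: psdD; [exact: psd1|exact: psd_gram]. Qed.

Let symC : (TTcirc T A B Cy Cs)^T = TTcirc T A B Cy Cs.
Proof. exact: TTcirc_sym. Qed.

Let gramE K : TTcirc T A B Cy Cs
    + (K - Kcirc T A B Cy Cs) *m G *m (K - Kcirc T A B Cy Cs)^T = TK K *m (TK K)^T.
Proof. exact: err_mx_gram. Qed.

Lemma feasible_pos K g X : feasible K g X -> 0 < g ->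
  strictly_admissible (TK K) g^-1 /\
  dual_value (TK K) rho g^-1 <= sdp_obj rho g X.
Proof.
move=> [_ _ _ pL] g0; have := lmi_feasible_pos symC symG uG g0 pL.
rewrite gramE => -[pS uS le_tr].
have sa : strictly_admissible (TK K) g^-1 by split=> //; rewrite invr_gt0.
by split=> //; rewrite dual_valueE // invrK /sdp_obj lerD2l.
Qed.

Lemma feasible_of_admissible K mu : causal K -> strictly_admissible (TK K) mu ->
  exists2 X, feasible K mu^-1 X & sdp_obj rho mu^-1 X = dual_value (TK K) rho mu.
Proof.
move=> cK sa; have [mu0 pS uS] := sa.
exists (mu^-1 *: resolvent (TK K *m (TK K)^T) mu).
  have g0 : 0 < mu^-1 by rewrite invr_gt0.
  have := @lmi_resolvent _ _ _ _ (K - Kcirc T A B Cy Cs) _ symC symG uG pG mu^-1.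
  by rewrite gramE invrK => /(_ g0 pS uS)[pX pL]; split=> //; exact: ltW.
by rewrite dual_valueE // /sdp_obj mxtraceZ.
Qed.

Lemma feasible_zero K : causal K -> TK K *m (TK K)^T = 0 -> feasible K 0 0.
Proof.
move=> cK S0; split=> //; first exact: psd0.
by apply: lmi_zero_feasible => //; rewrite gramE.
Qed.

Lemma worst_cost_le K g X : feasible K g X -> (worst K <= (sdp_obj rho g X)%:E)%E.
Proof.
move=> fK; apply: ge_ereal_sup => _ [P wP <-].
have [_ g_ge0 pX pL] := fK; have [gE|gN0] := eqVneq g 0; last first.
  have g0 : 0 < g by rewrite lt_def gN0.
  have [sa le_obj] := feasible_pos fK g0.
  by apply: le_trans (weak_duality P0_moment P0_cov sa wP) _; rewrite lee_fin.
(* With a zero multiplier the error operator is zero, so the cost is 0 and the objective is [\tr X],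
   which is nonnegative. *)
move: pL; rewrite gE => /(lmi_zero symG uG _ symC); rewrite gramE.
move=> /(_ (psd_gram _))/gram_eq0 ->; rewrite /cost.
under eq_integral do rewrite mul0mx.
rewrite [X in (_ <= X)%E](_ : _ = (\tr X)%:E); last by rewrite /sdp_obj mul0r add0r.
rewrite integral0_eq ?lee_fin ?psd_tr_ge0 // => x _.
by rewrite /sqnorm big1 // => i _; rewrite mxE expr0n.
Qed.

(** Absence of a duality gap for each causal estimator: the multiplier spending the whole budget
    yields a feasible point, and a zero error operator yields the zero point. *)
Lemma exists_feasible K : causal K ->
  exists g X, feasible K g X /\ ((sdp_obj rho g X)%:E <= worst K)%E.
Proof.
move=> cK; have [S0|SN0] := eqVneq (TK K *m (TK K)^T) 0.
  exists 0, 0; split; first exact: feasible_zero.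
  rewrite /sdp_obj mul0r add0r mxtrace0.
  have [P wP /le_trans] := wball_nonempty (TK K) rho P0_moment P0_cov.
  by apply; apply: ereal_sup_ubound; exists P.
have [mu sa tE] := exists_strictly_admissible rho0 SN0.
have [X fX objE] := feasible_of_admissible cK sa.
exists mu^-1, X; split=> //; rewrite objE.
have [wP <-] := linprob_optimal P0_moment P0_cov sa tE.
by apply: ereal_sup_ubound; exists (linprob P0 (1%:M + wc_gain (TK K) mu)).
Qed.

Lemma sdp_value_le K g X : feasible K g X ->
  (sdp_value T A B Cy Cs rho <= (sdp_obj rho g X)%:E)%E.
Proof. by move=> fK; apply: ereal_inf_lbound; exists (K, X, g). Qed.

Lemma dr_value_eq_sdp :
  dr_value A B Cy Cs P0 rho = sdp_value T A B Cy Cs rho.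
Proof.
apply/eqP; rewrite eq_le; apply/andP; split; apply: le_ereal_inf_tmp.
  move=> _ [[[K X] g] /= fK <-]; apply: le_trans (worst_cost_le fK).
  by apply: ereal_inf_lbound; exists K => //; case: fK.
move=> _ [K cK <-]; have [g [X [fK le_w]]] := exists_feasible cK.
exact: le_trans (sdp_value_le fK) le_w.
Qed.

(** An optimal [g] need not come from [exists_multiplier]; its dual value agrees with that of the
    multiplier found there, and uniqueness of the gain transfers the budget equation. *)
Lemma optimal_wc_gain K g X : sdp_optimal A B Cy Cs rho K g X -> 0 < g ->
  [/\ strictly_admissible (TK K) g^-1,
   \tr ((wc_gain (TK K) g^-1)^T *m wc_gain (TK K) g^-1) = rho ^+ 2 &
   worst K = (dual_value (TK K) rho g^-1)%:E].
Proof.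
move=> [fK objE] g0; have cK : causal K by case: fK.
have [sa le_obj] := feasible_pos fK g0.
have [S0|SN0] := eqVneq (TK K *m (TK K)^T) 0.
  (* If the error operator vanished, the zero point would give value at most 0, against an objective
     of at least [g * rho ^+ 2 > 0]. *)
  have := sdp_value_le (feasible_zero cK S0).
  rewrite -objE lee_fin {2}/sdp_obj mul0r add0r mxtrace0 => obj0.
  have := le_trans le_obj obj0.
  rewrite /dual_value /wc_gain (gram_eq0 S0) mulmx0 scaler0 mxtrace0 addr0 invrK.
  by rewrite leNgt mulr_gt0 // exprn_gt0.
have [nu sn tE] := exists_strictly_admissible rho0 SN0.
have [wP cE] := linprob_optimal P0_moment P0_cov sn tE.
have [Y fY objY] := feasible_of_admissible cK sn.
(* One inequality is optimality of [g] against the feasible point built from [nu], the other is weak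
   duality at the law attaining the value at [nu]. *)
have dE : dual_value (TK K) rho g^-1 = dual_value (TK K) rho nu.
  apply/eqP; rewrite eq_le; apply/andP; split.
    have := sdp_value_le fY; rewrite -objE objY lee_fin; exact: le_trans.
  by have := weak_duality P0_moment P0_cov sa wP; rewrite cE lee_fin.
have sE := wc_gain_unique P0_moment P0_cov sa sn tE dE.
split; rewrite ?sE //; apply/eqP; rewrite eq_le; apply/andP; split.
  by apply: ge_ereal_sup => _ [P wP' <-]; exact: weak_duality.
rewrite dE -cE; apply: ereal_sup_ubound.
by exists (linprob P0 (1%:M + wc_gain (TK K) nu)).
Qed.

End SDP.

Theorem theorem3p4 (R : realType) (n dw dy ds T : nat)
  (A : 'M[R]_n) (B : 'M[R]_(n, dw)) (Cy : 'M[R]_(dy, n)) (Cs : 'M[R]_(ds, n))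
  (P0 : probability ((n + T.-1 * dw + T * dy)%N.-tuple R) R) (rho : R) :
  (0 < T)%N -> 0 < rho ->
  detectable A Cy -> detectable A Cs -> controllable A B ->
  finite_second_moment P0 ->
  (forall i, (\int[P0]_x (tnth x i)%:E = 0)%E) ->
  (forall i j, (\int[P0]_x (tnth x i * tnth x j)%:E = ((i == j)%:R)%:E)%E) ->
  @dr_value R n dw dy ds T A B Cy Cs P0 rho = @sdp_value R n dw dy ds T A B Cy Cs rho /\
  (forall (K : 'M[R]_(T * ds, T * dy)) (g : R) (X : 'M[R]_(T * ds)),
     @sdp_optimal R n dw dy ds T A B Cy Cs rho K g X -> 0 < g ->
     let M := 1%:M - g^-1 *: ((@TK R n dw dy ds T A B Cy Cs K)^T *m @TK R n dw dy ds T A B Cy Cs K) in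
     [/\ M \in unitmx,
         @worst_cost R n dw dy ds T A B Cy Cs P0 rho K = @dr_value R n dw dy ds T A B Cy Cs P0 rho &
         exists Pstar : probability ((n + T.-1 * dw + T * dy)%N.-tuple R) R,
           [/\ forall E, measurable E ->
                 Pstar E = P0 ((fun x => vtup (invmx M *m tvec x)) @^-1` E),
               wball P0 rho Pstar &
               cost Pstar (@TK R n dw dy ds T A B Cy Cs K) = @worst_cost R n dw dy ds T A B Cy Cs P0 rho K]]).
Proof.
move=> _ rho0 _ _ _ mP0 _ cP0; split=> [|K g X opt g0 M].
  exact: dr_value_eq_sdp.
have [sa tE wE] := optimal_wc_gain rho0 mP0 cP0 opt g0; have [_ _ uS] := sa.
have [wP cE] := linprob_optimal mP0 cP0 sa tE.
have invM : invmx M = 1%:M + wc_gain (TK A B Cy Cs K) g^-1 by exact: invmx_gram.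
split; first exact: gram_unitmx.
  have [fK objE] := opt; apply/eqP; rewrite eq_le; apply/andP; split.
    by rewrite dr_value_eq_sdp // -objE; exact: worst_cost_le.
  by apply: ereal_inf_lbound; exists K => //; case: fK.
(* An image law by construction, so the pushforward formula holds by definition. *)
exists (linprob P0 (invmx M)); split; rewrite ?invM //.
by rewrite wE.
Qed.
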